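(* Let $l\in\mathbb{N}$ and let $K$ be a $\mathbb{Z}[t_1,t_1^{-1},\dots,t_l,t_l^{-1}]$-module which has a pair of valuations. Let $G=K\rtimes[t_1,\dots,t_l]$ and let $S$ be a finite generating set for $G$. Then $G$ is not almost convex with respect to $S$.
   Context: Pair of valuations: let $l\in\mathbb{N}$ and let $K$ be a $\mathbb{Z}[t_1,t_1^{-1},\dots,t_l,t_l^{-1}]$-module. A pair of functions $I_1,I_2:K\setminus\{0\}\to\mathbb{R}$ is a pair of valuations for $K$ if there are constants $C,b_1,\dots,b_l\in\mathbb{R}$ such that for all $k_1,k_2\in K\setminus\{0\}$ and all $i$: $I_1(t_ik_1)=I_1(k_1)+b_i$; $I_2(t_ik_1)=I_2(k_1)-b_i$; $I_1(-k_1)=I_1(k_1)$ and $I_2(-k_1)=I_2(k_1)$; and, whenever $k_1+k_2\ne0$, $I_1(k_1+k_2)\le\max(I_1(k_1),I_1(k_2))+C$ and $I_2(k_1+k_2)\le\max(I_2(k_1),I_2(k_2))+C$. $[t_1,\dots,t_l]$ denotes the free abelian group on $t_1,\dots,t_l$. Elements of $K\rtimes[t_1,\dots,t_l]$ are written as pairs $(m,k)$ with $m\in\mathbb{Z}^l$, $k\in K$, with multiplication $(m_1,k_1)(m_2,k_2)=(m_1+m_2,\,t^{m_2}k_1+k_2)$, where $t^{m}=t_1^{m_1}\cdots t_l^{m_l}$ for $m=(m_1,\dots,m_l)$. Almost convexity: let $G$ be a group with finite generating set $S$, let $\|g\|_S$ be the word length of $g$, and consider $G$ with the word metric $d$ (as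 the vertex set of its Cayley graph), a path being a sequence of group elements with consecutive ones at distance $1$. For $n\ge 2$, $G$ is not $n$-almost convex with respect to $S$ if there is a sequence of pairs $(x_i,y_i)\in G^2$ with $d(x_i,y_i)\le n$ such that the length of a shortest path from $x_i$ to $y_i$ all of whose points lie in the closed ball of radius $\max(\|x_i\|_S,\|y_i\|_S)$ about the identity tends to $\infty$ as $i\to\infty$; otherwise it is $n$-almost convex. By a theorem of Cannon this does not depend on $n\ge2$, and $G$ is called almost convex with respect to $S$ if it is $n$-almost convex for some (equivalently every) $n\ge2$.
   Formalization: The formal theorem also assumes that K is nonzero and that some constant b_i of the pair of valuations is nonzero; without this the claim fails, e.g. K = Z with trivial action, l = 1 and constant valuations gives G = Z^2, which is almost convex. *)

(* Defs.v *)
From HB Require Import structures.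
From mathcomp Require Import all_boot all_order all_algebra finmap.
From mathcomp Require Import monalg.
From mathcomp Require Import boolp reals.

Set Implicit Arguments.
Unset Strict Implicit.
Unset Printing Implicit Defensive.

Import GRing.Theory.

Local Open Scope fset_scope.
Local Open Scope ring_scope.

(* The Laurent polynomial ring Z[t_1, t_1^-1, ..., t_l, t_l^-1], as the group
   ring of Z^l: finitely supported functions p : Z^l -> int, where p@_m is the
   coefficient of t^m = t_1^m_1 ... t_l^m_l and << c *g m >> is the single term
   c t^m.  The ring structure of {malg _[_]} is not available here because it
   asks for exponent monoids without nontrivial units. *)
Definition laurent (l : nat) := {malg int['rV[int]_l]}.

HB.instance Definition _ (l : nat) := GRing.Zmodule.on (laurent l).

Section LaurentRing.
Variable l : nat.
Implicit Types (p q r : laurent l) (m : 'rV[int]_l).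

Definition laurent1 : laurent l := << 1 *g 0 >>.

Definition laurentM p q : laurent l :=
  \sum_(m1 <- msupp p) \sum_(m2 <- msupp q) << p@_m1 * q@_m2 *g m1 + m2 >>.

Lemma laurentMw (d1 d2 : {fset 'rV[int]_l}) p q :
  msupp p `<=` d1 -> msupp q `<=` d2 ->
  laurentM p q = \sum_(m1 <- d1) \sum_(m2 <- d2) << p@_m1 * q@_m2 *g m1 + m2 >>.
Proof.
move=> le1 le2; rewrite /laurentM (big_fset_incl _ le1) /=.
  apply/eq_bigr=> m1 _; apply/big_fset_incl => // m _ /mcoeff_outdom ->.
  by rewrite mulr0 monalgU0.
move=> m _ /mcoeff_outdom pm.
by rewrite big1 => // m' _; rewrite pm mul0r monalgU0.
Qed.

Lemma laurentMUU c1 c2 m1 m2 :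
  laurentM << c1 *g m1 >> << c2 *g m2 >> = << c1 * c2 *g m1 + m2 >>.
Proof. by rewrite (laurentMw msuppU_le msuppU_le) !big_seq_fset1 !mcoeffUU. Qed.

Lemma laurentMC : commutative laurentM.
Proof.
move=> p q; rewrite /laurentM exchange_big /=.
by apply/eq_bigr=> i _; apply/eq_bigr=> j _; rewrite mulrC addrC.
Qed.

Lemma laurentMDl : left_distributive laurentM +%R.
Proof.
move=> p q r.
rewrite (laurentMw (msuppD_le p q) (fsubset_refl _)).
rewrite (laurentMw (fsubsetUl (msupp p) (msupp q)) (fsubset_refl (msupp r))).
rewrite (laurentMw (fsubsetUr (msupp p) (msupp q)) (fsubset_refl (msupp r))).
rewrite -big_split /=; apply/eq_bigr=> m1 _.
rewrite -big_split /=; apply/eq_bigr=> m2 _.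
by rewrite mcoeffD mulrDl monalgUD.
Qed.

Lemma laurentM0l p : laurentM 0 p = 0.
Proof. by rewrite /laurentM msupp0 big_seq_fset0. Qed.

Lemma laurentMDr : right_distributive laurentM +%R.
Proof. by move=> p q r; rewrite ![laurentM p _]laurentMC laurentMDl. Qed.

Lemma laurentM_suml (I : Type) (s : seq I) (F : I -> laurent l) q :
  laurentM (\sum_(i <- s) F i) q = \sum_(i <- s) laurentM (F i) q.
Proof.
exact: (big_morph (laurentM^~ q) (fun a b => laurentMDl a b q) (laurentM0l q)).
Qed.

Lemma laurentM_sumr (I : Type) (s : seq I) (F : I -> laurent l) q :
  laurentM q (\sum_(i <- s) F i) = \sum_(i <- s) laurentM q (F i).
Proof.
by rewrite laurentMC laurentM_suml; apply/eq_bigr=> i _; rewrite laurentMC.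
Qed.

Lemma laurentMEl p q :
  laurentM p q = \sum_(m <- msupp p) laurentM << p@_m *g m >> q.
Proof. by rewrite {1}[p]monalgE (laurentM_suml (msupp p)). Qed.

Lemma laurentMEr p q :
  laurentM p q = \sum_(m <- msupp q) laurentM p << q@_m *g m >>.
Proof. by rewrite {1}[q]monalgE (laurentM_sumr (msupp q)). Qed.

Lemma laurentMA : associative laurentM.
Proof.
move=> p q r.
rewrite (laurentMEl p q) (laurentM_suml (msupp p)) laurentMEl.
apply/eq_bigr=> k1 _.
rewrite (laurentMEl q r) (laurentM_sumr (msupp q)).
rewrite (laurentMEr _ q) (laurentM_suml (msupp q)); apply/eq_bigr=> k2 _.
rewrite (laurentMEr _ r) (laurentM_sumr (msupp r)).
rewrite (laurentMEr _ r); apply/eq_bigr=> k3 _.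
by rewrite !laurentMUU mulrA addrA.
Qed.

Lemma laurentM1 : left_id laurent1 laurentM.
Proof.
move=> p; rewrite laurentMEr [RHS]monalgE; apply/eq_bigr=> m _.
by rewrite laurentMUU mul1r add0r.
Qed.

Lemma laurent1_neq0 : laurent1 != 0.
Proof. by rewrite monalgU_eq0 oner_eq0. Qed.

HB.instance Definition _ := GRing.Zmodule_isComNzRing.Build (laurent l)
  laurentMA laurentMC laurentM1 laurentMDl laurent1_neq0.

Definition tmon m : laurent l := << 1 *g m >>.

Definition tvar (i : 'I_l) : laurent l := tmon (delta_mx 0 i).

Lemma tmon0 : tmon 0 = 1.
Proof. by []. Qed.

Lemma tmonD m1 m2 : tmon (m1 + m2) = tmon m1 * tmon m2.
Proof. by rewrite [RHS]laurentMUU mulr1. Qed.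

End LaurentRing.

(* A module over Z[t_i^+-1] is a [K : lmodType (laurent l)]; the valuations are
   total functions whose values at 0 are irrelevant.  The definition allows
   K = 0 and b = 0 (for every K, constant I1 and I2 satisfy it with b = 0), so
   these cases have to be excluded separately to get consequences for the
   semidirect product: they include Z^l and Z x Z, which are almost convex. *)
Definition pair_of_valuations (R : realType) (l : nat)
    (K : lmodType (laurent l)) (C : R) (b : 'I_l -> R) (I1 I2 : K -> R) : Prop :=
  [/\ forall (k : K) (i : 'I_l), k != 0 -> I1 (tvar i *: k) = I1 k + b i,
      forall (k : K) (i : 'I_l), k != 0 -> I2 (tvar i *: k) = I2 k - b i,
      forall k : K, k != 0 -> I1 (- k) = I1 k /\ I2 (- k) = I2 k
    & forall k1 k2 : K, k1 != 0 -> k2 != 0 -> k1 + k2 != 0 ->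
        I1 (k1 + k2) <= Num.max (I1 k1) (I1 k2) + C /\
        I2 (k1 + k2) <= Num.max (I2 k1) (I2 k2) + C].

Definition semidirect (l : nat) (K : lmodType (laurent l)) : Type :=
  ('rV[int]_l * K)%type.

HB.instance Definition _ (l : nat) (K : lmodType (laurent l)) :=
  Choice.on (semidirect K).

Section SemidirectGroup.
Variables (l : nat) (K : lmodType (laurent l)).
Implicit Types g h : semidirect K.

Definition semidirect1 : semidirect K := (0, 0).

Definition semidirectM g h : semidirect K :=
  (g.1 + h.1, tmon h.1 *: g.2 + h.2).

Definition semidirectV g : semidirect K := (- g.1, - (tmon (- g.1) *: g.2)).

Lemma semidirectMA : associative semidirectM.
Proof.
move=> [m1 k1] [m2 k2] [m3 k3]; congr (_, _) => /=; first by rewrite addrA.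
by rewrite scalerDr scalerA -tmonD addrA [m2 + m3]addrC.
Qed.

Lemma semidirectM1g : left_id semidirect1 semidirectM.
Proof. by move=> [m k]; rewrite /semidirectM /= add0r scaler0 add0r. Qed.

Lemma semidirectMg1 : right_id semidirect1 semidirectM.
Proof. by move=> [m k]; rewrite /semidirectM /= !addr0 tmon0 scale1r. Qed.

Lemma semidirectMVg : left_inverse semidirect1 semidirectV semidirectM.
Proof.
move=> [m k]; congr (_, _) => /=; first by rewrite addNr.
by rewrite scalerN scalerA -tmonD subrr tmon0 scale1r addNr.
Qed.

Lemma semidirectMgV : right_inverse semidirect1 semidirectV semidirectM.
Proof. by move=> [m k]; congr (_, _) => /=; rewrite subrr. Qed.

HB.instance Definition _ := isGroup.Build (semidirect K)
  semidirectMA semidirectM1g semidirectMg1 semidirectMVg semidirectMgV.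

End SemidirectGroup.

(* The least n satisfying P; the value 0 when there is none is never met below
   as long as the finite set under consideration generates the group. *)
Definition least (P : nat -> Prop) : nat :=
  if pselect (exists n, `[< P n >]) is left exP then ex_minn exP else 0%N.

Section WordMetric.
Variables (G : groupType) (S : {fset G}).
Implicit Types (g x y : G) (w p : seq G) (n r : nat).

Definition is_word w g : Prop :=
  all (fun s => (s \in S) || (s^-1%g \in S)) w /\ (\big[*%g/1%g]_(s <- w) s)%g = g.

Definition generates : Prop := forall g, exists w, is_word w g.

Definition wlen g : nat := least (fun n => exists2 w, is_word w g & size w = n).

Definition wdist x y : nat := wlen (x^-1 * y)%g.

Definition is_ball_path r x y p : Prop :=
  [/\ path (fun u v => wdist u v == 1%N) x p, last x p = y
    & all (fun u => wlen u <= r)%N (x :: p)].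

Definition ball_dist r x y : nat :=
  least (fun n => exists2 p, is_ball_path r x y p & size p = n).

Definition not_n_almost_convex n : Prop :=
  exists x y : nat -> G,
    (forall i, (wdist (x i) (y i) <= n)%N) /\
    (forall L : nat, exists N : nat, forall i : nat, (N <= i)%N ->
       (L <= ball_dist (maxn (wlen (x i)) (wlen (y i))) (x i) (y i))%N).

Definition n_almost_convex n : Prop := ~ not_n_almost_convex n.

(* By Cannon's theorem "some n >= 2" gives the same notion.  The quantifier is
   universal because points here are vertices of the Cayley graph only, whereas
   descending from n = 2 in the usual argument also uses midpoints of edges. *)
Definition almost_convex : Prop := forall n, (2 <= n)%N -> n_almost_convex n.

End WordMetric.

(* Main.v *)
(* Write h(m) = sum_i b_i m_i and kappa(m, k) = t^-m k.  Along a word with partial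
   products g_j, kappa is the sum of the translates t^-g_j kappa(s_j), on which I1
   is -h(g_j) + O(1) and I2 is h(g_j) + O(1).  After exponentiation the
   quasi-ultrametric inequalities become subadditivity up to a factor 2, so
   exp(mu I1(kappa)) and exp(mu I2(kappa)) are bounded by constant multiples of the
   sums of exp(-mu h(g_j)) and exp(mu h(g_j)).  If h moves by at most 1 at each
   step and returns near 0, then the product of these two sums over a walk of
   length r is O(exp(mu r / 2)).
   Let s be a generator with h = 1.  The element (0, t^(N s) k + t^(-N s) k) is the
   product, in either order, of two commuting conjugates of k by s^N and s^-N;
   hence multiplying it by s^q or by s^-q shortens one of the two words, giving
   points of length at most 4 N - q + O(1) at distance at most 2 q.  A path of
   bounded length between these two crosses height 0 at a point where both
   valuations of kappa are still N - O(1), hence of length at least 4 N - O(1). *)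
Require Import Defs.
From mathcomp Require Import all_boot all_order all_algebra finmap.
From mathcomp Require Import monalg.
From mathcomp Require Import boolp reals sequences exp.
From mathcomp Require Import zify ring lra.

Set Implicit Arguments.
Unset Strict Implicit.
Unset Printing Implicit Defensive.

Import Order.TTheory GRing.Theory Num.Theory.

Local Open Scope ring_scope.

Section Quasinorm.
Variables (R : realFieldType) (V : zmodType) (rho : V -> R) (lambda : R).
Hypotheses (rho0 : rho 0 = 0) (rho_ge0 : forall x, 0 <= rho x).
Hypotheses (lambda_ge1 : 1 <= lambda) (lambda_sqr : lambda ^+ 2 <= 2).
Hypothesis rhoD : forall x y, rho (x + y) <= lambda * Num.max (rho x) (rho y).

Lemma quasinorm_half_split (s : seq V) : s != [::] ->
  exists s1 x s2, [/\ s = s1 ++ x :: s2,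
    2 * (\sum_(y <- s1) rho y) <= \sum_(y <- s) rho y
    & 2 * (\sum_(y <- s2) rho y) <= \sum_(y <- s) rho y].
Proof.
move=> s_neq0.
have sum_ge0 (u : seq V) : 0 <= \sum_(y <- u) rho y.
  by apply: sumr_ge0 => *; exact: rho_ge0.
have /ex_minnP[i] : exists i, (i < size s)%N &&
    (\sum_(y <- s) rho y <= 2 * \sum_(y <- take i.+1 s) rho y).
  exists (size s).-1; rewrite prednK ?lt0n ?size_eq0 // take_size leqnn /=.
  by have := sum_ge0 s; lra.
case/andP=> lt_is le_i min_i.
have x0 : V := 0.
exists (take i s), (nth x0 s i), (drop i.+1 s).
rewrite -drop_nth // cat_take_drop; split=> //.
  case: i lt_is le_i min_i => [|i] lt_is _ min_i.
    by rewrite take0 big_nil mulr0.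
  rewrite leNgt; apply/negP => /ltW lt_i.
  by have := min_i i; rewrite (ltnW lt_is) lt_i ltnn => /(_ isT).
move: le_i; rewrite -{1 4}(cat_take_drop i.+1 s) big_cat /=; lra.
Qed.

Lemma quasinorm_sum_le (s : seq V) : rho (\sum_(x <- s) x) <= 2 * \sum_(x <- s) rho x.
Proof.
have [n] := ubnP (size s); elim: n s => // n IHn s.
have [-> _|/quasinorm_half_split[s1 [x [s2 [-> le1 le2]]]]] := eqVneq s [::].
  by rewrite !big_nil rho0 mulr0.
rewrite size_cat /= addnS ltnS => lt_s.
have /IHn IH1 : (size s1 < n)%N by apply: leq_trans lt_s; rewrite ltnS leq_addr.
have /IHn IH2 : (size s2 < n)%N by apply: leq_trans lt_s; rewrite ltnS leq_addl.
move: le1 le2; rewrite !big_cat !big_cons /= => le1 le2.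
set a1 := \sum_(y <- s1) rho y in le1 le2 IH1 *.
set a2 := \sum_(y <- s2) rho y in le1 le2 IH2 *.
set a := a1 + (rho x + a2) in le1 le2 *.
have a1_ge0 : 0 <= a1 by apply: sumr_ge0 => *; exact: rho_ge0.
have a2_ge0 : 0 <= a2 by apply: sumr_ge0 => *; exact: rho_ge0.
have x_le : rho x <= a by rewrite /a; lra.
have a_ge0 : 0 <= a by rewrite /a; have := rho_ge0 x; lra.
have le_lam u : u <= a -> u <= lambda * a.
  by move=> /le_trans -> //; rewrite ler_peMl.
apply: le_trans (rhoD _ _) _.
apply: (@le_trans _ _ (lambda * (lambda * a))).
  apply: ler_wpM2l; first by apply: le_trans lambda_ge1.
  rewrite ge_max; apply/andP; split; first by apply: le_lam; lra.
  apply: le_trans (rhoD _ _) _; apply: ler_wpM2l.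
    by apply: le_trans lambda_ge1.
  by rewrite ge_max x_le /=; lra.
by rewrite mulrA -expr2; exact: ler_wpM2r.
Qed.

End Quasinorm.

Section Walk.
Variable R : realType.

Lemma geometric_le (x : R) n : 0 <= x < 1 -> \sum_(j < n) x ^+ j <= (1 - x)^-1.
Proof.
move=> /andP[x0 x1]; rewrite -[leRHS]mul1r ler_pdivlMr ?subr_gt0 //.
have -> : (\sum_(j < n) x ^+ j) * (1 - x) = 1 - x ^+ n.
  by rewrite -opprB mulrN mulrC -subrX1 opprB.
by rewrite gerBl exprn_ge0.
Qed.

Lemma geometric_dist_le (x : R) q n : 0 <= x < 1 ->
  \sum_(j < n) x ^+ ((q - j) + (j - q)) <= 2 / (1 - x).
Proof.
move=> x01; have [x0 x1] := andP x01.
suff: \sum_(j < n) x ^+ ((q - j) + (j - q)) <=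
    \sum_(j < q) x ^+ j + \sum_(j < n) x ^+ j.
  have := geometric_le q x01; have := geometric_le n x01.
  by rewrite mulrDl mul1r; lra.
elim: q n => [|q IHq] n.
  by rewrite big_ord0 add0r; apply: ler_sum => j _; rewrite sub0n add0n subn0.
case: n => [|n].
  by rewrite !big_ord0 addr0; apply: sumr_ge0 => *; rewrite exprn_ge0.
rewrite [leLHS]big_ord_recl [X in X + _ <= _]/= subn0 sub0n addn0.
under eq_bigr => j _ do rewrite lift0 !subSS.
have := IHq n; rewrite big_ord_recr big_ord_recr /=.
have : x ^+ q.+1 <= x ^+ q by rewrite exprS ler_piMl ?exprn_ge0 // ltW.
have : 0 <= x ^+ n by rewrite exprn_ge0.
lra.
Qed.

(* The time spent on the way from one extremum to the other, and from the ends
   of the walk to the extrema, leaves a budget for every other point. *)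
Lemma walk_height_le (h : nat -> R) r p q j :
  (forall i k, (i <= k <= r)%N -> `|h k - h i| <= (k - i)%:R) ->
  h 0%N = 0 -> `|h r| <= 1 -> (p <= r)%N -> (q <= r)%N ->
  (forall i, (i <= r)%N -> h p <= h i <= h q) -> (j <= r)%N ->
  exists2 c, c \in [:: 0; q; r]%N &
    4 * h j <= r%:R + 1 + 2 * (h q + h p) - ((c - j) + (j - c))%:R.
Proof.
move=> lip h0 hr pr qr ext jr.
have step i k : (i <= k <= r)%N ->
    h k - h i <= k%:R - i%:R /\ h i - h k <= k%:R - i%:R.
  move=> ikr; have := lip i k ikr; have /andP[ik _] := ikr.
  by rewrite ler_norml natrB // => /andP[? ?]; split; lra.
have hjq : h j <= h q by have /andP[] := ext j jr.
have hq0 : 0 <= h q by have /andP[] := ext 0%N (leq0n _); rewrite h0.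
have [hr1 hr2] : -1 <= h r /\ h r <= 1 by apply/andP; rewrite -ler_norml.
have start i : (i <= r)%N -> h i <= i%:R /\ - h i <= i%:R.
  by move=> ir; have [] := step 0%N i ir; rewrite h0; split; lra.
have finish i : (i <= r)%N -> h i <= r%:R - i%:R + 1 /\ - h i <= r%:R - i%:R + 1.
  by move=> ir; have := step i r; rewrite ir leqnn => /(_ isT)[? ?]; split; lra.
have [Bq Bq'] := (start q qr, finish q qr).
have [Bp Bp'] := (start p pr, finish p pr).
have [pq|/ltnW qp] := leqP p q.
  have := step p q; rewrite pq qr => /(_ isT)[Bpq _].
  move: Bp.2 Bq'.1 => {}Bp {}Bq.
  have [jp|/ltnW pj] := leqP j p.
    have := step j p; rewrite jp pr => /(_ isT)[_ Bj].
    exists 0%N; rewrite ?inE // sub0n subn0 add0n.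
    by clear -Bj Bpq Bp Bq hjq hq0; lra.
  have := step p j; rewrite pj jr => /(_ isT)[Bj _].
  exists q; rewrite ?inE ?eqxx ?orbT //.
  have [jq|/ltnW qj] := leqP j q.
    rewrite (eqP jq) addn0 natrB //.
    by clear -Bj Bpq Bp Bq hjq; lra.
  move: (finish j jr).1 => Bj2; rewrite (eqP qj) add0n natrB //.
  by clear -Bj2 Bpq Bp Bq hjq; lra.
have := step q p; rewrite qp pr => /(_ isT)[_ Bqp].
move: Bp'.2 Bq.1 => {}Bp {}Bq.
have [jq|/ltnW qj] := leqP j q.
  exists q; rewrite ?inE ?eqxx ?orbT // (eqP jq) addn0 natrB //.
  by move: (start j jr).1 => Bj; clear -Bj Bqp Bp Bq hjq; lra.
have [jp|/ltnW pj] := leqP j p.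
  have := step j p; rewrite jp pr => /(_ isT)[_ Bj].
  exists q; rewrite ?inE ?eqxx ?orbT // (eqP qj) add0n natrB //.
  by clear -Bj Bqp Bp Bq hjq; lra.
have := step p j; rewrite pj jr => /(_ isT)[Bj _].
exists r; rewrite ?inE ?eqxx ?orbT // (eqP jr) addn0 natrB //.
by clear -Bj Bqp Bp Bq hjq hq0; lra.
Qed.

Lemma walk_sum_le (mu : R) (h : nat -> R) r p q : 0 < mu ->
  (forall i k, (i <= k <= r)%N -> `|h k - h i| <= (k - i)%:R) ->
  h 0%N = 0 -> `|h r| <= 1 -> (p <= r)%N -> (q <= r)%N ->
  (forall i, (i <= r)%N -> h p <= h i <= h q) ->
  \sum_(j < r) expR (mu * h j) <=
    6 / (1 - expR (- (mu / 4))) * expR (mu / 4 * (r%:R + 1 + 2 * (h q + h p))).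
Proof.
move=> mu0 lip h0 hr pr qr ext.
set x := expR (- (mu / 4)); set E := expR (_ * (_ + _)).
have x01 : 0 <= x < 1 by rewrite expR_ge0 expR_lt1 /=; lra.
have bound j : (j < r)%N -> expR (mu * h j) <=
    E * (x ^+ ((0 - j) + (j - 0)) + x ^+ ((q - j) + (j - q)) + x ^+ ((r - j) + (j - r))).
  move=> /ltnW jr; have [c cin hc] := walk_height_le lip h0 hr pr qr ext jr.
  apply: (@le_trans _ _ (E * x ^+ ((c - j) + (j - c)))).
    rewrite /E /x -expRM_natl -expRD ler_expR.
    apply: le_trans (_ : mu / 4 * (4 * h j) <= _); first by lra.
    apply: le_trans (ler_wpM2l _ hc) _; first by lra.
    by rewrite mulrBr; lra.
  rewrite ler_wpM2l ?expR_ge0 //.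
  have pos n : 0 <= x ^+ n by rewrite exprn_ge0 // expR_ge0.
  move: cin (pos ((0 - j) + (j - 0))%N) (pos ((q - j) + (j - q))%N) (pos ((r - j) + (j - r))%N).
  by rewrite !inE => /or3P[] /eqP ->; lra.
apply: (@le_trans _ _ (\sum_(j < r) E * (x ^+ ((0 - j) + (j - 0)) +
    x ^+ ((q - j) + (j - q)) + x ^+ ((r - j) + (j - r))))).
  by apply: ler_sum => j _; exact: bound.
rewrite -mulr_sumr [leRHS]mulrC ler_wpM2l ?expR_ge0 // !big_split /=.
have := geometric_dist_le 0 r x01; have := geometric_dist_le q r x01.
have := geometric_dist_le r r x01; lra.
Qed.

Lemma walk_sum_prod_le (mu : R) : 0 < mu -> exists2 D : R, 0 < D &
  forall (h : nat -> R) r,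
    (forall j, (j < r)%N -> `|h j.+1 - h j| <= 1) -> h 0%N = 0 -> `|h r| <= 1 ->
    (\sum_(j < r) expR (mu * h j)) * (\sum_(j < r) expR (- (mu * h j))) <=
    D * expR (mu / 2 * (r%:R + 1)).
Proof.
move=> mu0; set A := 6 / (1 - expR (- (mu / 4))).
have A0 : 0 < A by rewrite divr_gt0 // subr_gt0 expR_lt1; lra.
exists (A ^+ 2) => [|h r step h0 hr]; first by rewrite exprn_gt0.
have lip i k : (i <= k <= r)%N -> `|h k - h i| <= (k - i)%:R.
  move=> /andP[+ kr]; elim: k kr => [|k IHk] kr.
    by rewrite leqn0 => /eqP ->; rewrite subrr normr0.
  rewrite leq_eqVlt => /predU1P[->|]; first by rewrite subrr normr0.
  rewrite ltnS => ik; rewrite subSn // -natr1.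
  rewrite -(subrK (h k) (h k.+1)) -addrA addrC (le_trans (ler_normD _ _)) //.
  by rewrite lerD // ?step // IHk // ltnW.
have [p [q [pr qr ext]]] : exists p q, [/\ (p <= r)%N, (q <= r)%N &
    forall i, (i <= r)%N -> h p <= h i <= h q].
  case: (@Order.TotalTheory.arg_minP _ _ _ (ord0 : 'I_r.+1) predT (fun i => h i)) => // p _ minp.
  case: (@Order.TotalTheory.arg_maxP _ _ _ (ord0 : 'I_r.+1) predT (fun i => h i)) => // q _ maxq.
  exists p, q; split; rewrite -1?ltnS // => i; rewrite -ltnS => ir.
  by have := minp (Ordinal ir) isT; have := maxq (Ordinal ir) isT => /= -> ->.
have up := walk_sum_le mu0 lip h0 hr pr qr ext.
have down : \sum_(j < r) expR (mu * - h j) <=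
    A * expR (mu / 4 * (r%:R + 1 + 2 * (- h p + - h q))).
  apply: (@walk_sum_le mu (fun j => - h j) r q p mu0) => //.
  - by move=> i k /lip; rewrite -opprD normrN.
  - by rewrite h0 oppr0.
  - by rewrite normrN.
  - by move=> i /ext; rewrite !lerN2 andbC.
under [X in _ * X <= _]eq_bigr => j _ do rewrite -mulrN.
apply: le_trans (ler_pM _ _ up down) _.
- by apply: sumr_ge0 => *; exact: expR_ge0.
- by apply: sumr_ge0 => *; exact: expR_ge0.
rewrite mulrACA -expr2 -expRD; apply: ler_wpM2l; first by rewrite exprn_ge0 ?ltW.
rewrite ler_expR; lra.
Qed.

End Walk.

Lemma leastP (P : nat -> Prop) : (exists n, P n) -> P (least P).
Proof.
move=> [n Pn]; rewrite /least; case: pselect => [exP|[]].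
  by case: ex_minnP => m /asboolP.
by exists n; apply/asboolP.
Qed.

Lemma least_le (P : nat -> Prop) n : P n -> (least P <= n)%N.
Proof.
move=> Pn; rewrite /least; case: pselect => [exP|//].
by case: ex_minnP => m _ -> //; apply/asboolP.
Qed.

Section WordLength.
Variables (G : groupType) (S : {fset G}).
Hypothesis genS : generates S.
Implicit Types (g x y z : G).

Lemma wlen_word g : exists2 w, is_word S w g & size w = wlen S g.
Proof.
apply: (leastP (P := fun n => exists2 w, is_word S w g & size w = n)).
by have [w wg] := genS g; exists (size w), w.
Qed.

Lemma wlen_le_size w g : is_word S w g -> (wlen S g <= size w)%N.
Proof. by move=> wg; apply: least_le; exists w. Qed.

Lemma wlen1 : wlen S 1%g = 0%N.
Proof.
by apply/eqP; rewrite -leqn0 (@wlen_le_size [::]) //; split; rewrite ?big_nil.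
Qed.

Lemma wlenM_le g h : (wlen S (g * h)%g <= wlen S g + wlen S h)%N.
Proof.
have [u [uS <-] <-] := wlen_word g; have [v [vS <-] <-] := wlen_word h.
by rewrite -size_cat; apply: wlen_le_size; split; rewrite ?all_cat ?uS // big_cat.
Qed.

Lemma wlenV_le g : (wlen S g^-1%g <= wlen S g)%N.
Proof.
have [w [wS <-] <-] := wlen_word g.
have -> : size w = size (rev [seq s^-1%g | s <- w]) by rewrite size_rev size_map.
apply: wlen_le_size; split.
  rewrite all_rev all_map; apply: sub_all wS => s /=; by rewrite invgK orbC.
elim: w {wS} => [|s w IHw]; first by rewrite /rev /= !big_nil invg1.
rewrite /= rev_cons -cats1 big_cat /= IHw !big_cons big_nil mulg1.
by rewrite invgM.
Qed.

Lemma wlenV g : wlen S g^-1%g = wlen S g.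
Proof. by apply/eqP; rewrite eqn_leq wlenV_le -{1}[g]invgK wlenV_le. Qed.

Lemma wlenX_le g n : (wlen S (g ^+ n)%g <= n * wlen S g)%N.
Proof.
elim: n => [|n IHn]; first by rewrite expg0 wlen1.
by rewrite expgS mulSn (leq_trans (wlenM_le _ _)) // leq_add2l.
Qed.

Lemma wlenX_le1 g n : (wlen S g <= 1)%N -> (wlen S (g ^+ n)%g <= n)%N.
Proof.
by move=> g1; rewrite (leq_trans (wlenX_le _ _)) // -[leqRHS]muln1 leq_mul2l g1 orbT.
Qed.

Lemma wdist_mulV_le g h : (wdist S (g * h)%g (g * h^-1)%g <= 2 * wlen S h)%N.
Proof.
rewrite /wdist invgM -mulgA mulKg -invgM wlenV.
by rewrite (leq_trans (wlenM_le _ _)) // mul2n addnn.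
Qed.

Lemma wlen_updown_le g h N q : (wlen S g <= 1)%N -> (q <= N)%N ->
  (wlen S ((g ^+ N)^-1 * h * g ^+ N * (g ^+ N * h * (g ^+ N)^-1) * g ^+ q)%g <=
    4 * N - q + 2 * wlen S h)%N.
Proof.
move=> g1 qN.
have -> : ((g ^+ N)^-1 * h * g ^+ N * (g ^+ N * h * (g ^+ N)^-1) * g ^+ q =
    (g ^+ N)^-1 * h * g ^+ (N + N) * h * (g ^+ (N - q))^-1)%g.
  have -> : ((g ^+ (N - q))^-1 = (g ^+ N)^-1 * g ^+ q)%g.
    by rewrite -{2}(subnKC qN) expgnDr invgM mulgVK.
  by rewrite expgnDr !mulgA.
have := wlenX_le1 N g1; have := wlenX_le1 (N + N) g1.
have := wlenX_le1 (N - q) g1.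
have := wlenM_le ((g ^+ N)^-1 * h * g ^+ (N + N) * h)%g (g ^+ (N - q))^-1%g.
have := wlenM_le ((g ^+ N)^-1 * h * g ^+ (N + N))%g h.
have := wlenM_le ((g ^+ N)^-1 * h)%g (g ^+ (N + N))%g.
have := wlenM_le (g ^+ N)^-1%g h.
rewrite !wlenV; do !move: (wlen S _) => ?; lia.
Qed.

Lemma wlen_le1 g : (wlen S g <= 1)%N -> [\/ g = 1%g, g \in S | g^-1%g \in S].
Proof.
have [w [wS <-] <-] := wlen_word g.
case: w wS => [|s [|//]] wS; first by rewrite big_nil; constructor 1.
rewrite big_seq1 => _; move: wS; rewrite /= andbT => /orP[]; first by constructor 2.
by constructor 3.
Qed.

Lemma wlen_mem_le1 g : g \in S -> (wlen S g <= 1)%N.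
Proof. by move=> gS; apply: (@wlen_le_size [:: g]); split; rewrite /= ?gS ?big_seq1. Qed.

Lemma walk_of_wlen z : exists P : nat -> G, [/\ P 0%N = 1%g, P (wlen S z) = z
  & forall i, (i < wlen S z)%N -> (wlen S ((P i)^-1 * P i.+1)%g <= 1)%N].
Proof.
have [w [wS wz] <-] := wlen_word z.
exists (fun i => \big[*%g/1%g]_(s <- take i w) s)%g; split=> [||i iw].
- by rewrite take0 big_nil.
- by rewrite take_size.
rewrite (take_nth 1%g iw) -cats1 big_cat /= big_seq1 mulKg.
apply: (@wlen_le_size [:: nth 1%g w i]); split; last by rewrite big_seq1.
by rewrite /= (allP wS) // mem_nth.
Qed.

Lemma ball_path_trans r x y z :
  (exists p, is_ball_path S r x y p) -> (exists p, is_ball_path S r y z p) ->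
  exists p, is_ball_path S r x z p.
Proof.
move=> [p [pp py ap]] [q [qq qz aq]]; exists (p ++ q); split.
- by rewrite cat_path pp py.
- by rewrite last_cat py.
by rewrite -cat_cons all_cat ap; move: aq => /= /andP[].
Qed.

Lemma ball_path_sym r x y :
  (exists p, is_ball_path S r x y p) -> exists p, is_ball_path S r y x p.
Proof.
move=> [p []]; elim: p x => [|u p IHp] x /=.
  by move=> _ -> a; exists [::].
move=> /andP[xu up] uy /and3P[ax au ap].
apply: ball_path_trans (IHp u up uy _) _; first by rewrite /= au.
exists [:: x]; split; rewrite /= ?au ?ax // andbT.
by rewrite /wdist -wlenV invgM invgK.
Qed.

Lemma ball_path_to1 r x : (wlen S x <= r)%N -> exists p, is_ball_path S r x 1%g p.
Proof.
have [n] := ubnP (wlen S x); elim: n x => // n IHn x; rewrite ltnS => xn xr.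
have [w [wS wx] sw] := wlen_word x.
case: w => [|s w] in wS wx sw; first by exists [::]; split; rewrite -?wx ?big_nil //= wlen1.
have [ws wE] : exists w' s', s :: w = rcons w' s' by rewrite lastI; exists (belast s w), (last s w).
move: wE => [s' wE]; rewrite {s w}wE in wS wx sw.
rewrite all_rcons in wS; have [s'S wsS] := andP wS.
pose u := (\big[*%g/1%g]_(s <- ws) s)%g.
have xE : x = (u * s')%g by rewrite -wx -cats1 big_cat /= big_seq1.
have lu : (wlen S u <= size ws)%N by apply: wlen_le_size; split.
have ls : (wlen S s' <= 1)%N.
  by apply: (@wlen_le_size [:: s']); split; rewrite ?big_seq1 //= s'S.
have := wlenM_le u s'; rewrite -xE -sw size_rcons => le1.
have l1 : wlen S s' = 1%N.
  apply/eqP; rewrite eqn_leq ls -(leq_add2l (size ws)) addn1.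
  by rewrite (leq_trans le1) // leq_add2r.
have lux : (wlen S u < wlen S x)%N by rewrite -sw size_rcons ltnS.
apply: (@ball_path_trans _ _ u).
  exists [:: u]; split; rewrite //= ?xr ?(leq_trans (ltnW lux)) // andbT.
  by rewrite /wdist xE invgM mulgVK wlenV l1.
by apply: IHn; [apply: leq_trans xn|apply: leq_trans (ltnW lux) _].
Qed.

Lemma walk_of_ball_dist r x y L : (wlen S x <= r)%N -> (wlen S y <= r)%N ->
  (ball_dist S r x y < L)%N ->
  exists (P : nat -> G) n, [/\ (n < L)%N, P 0%N = x, P n = y,
    forall i, (i <= n)%N -> (wlen S (P i) <= r)%N
    & forall i, (i < n)%N -> (wlen S ((P i)^-1 * P i.+1)%g <= 1)%N].
Proof.
move=> xr yr.
have : exists2 p, is_ball_path S r x y p & size p = ball_dist S r x y.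
  apply: (leastP (P := fun n => exists2 p, is_ball_path S r x y p & size p = n)).
  have [p pP] := ball_path_trans (ball_path_to1 xr) (ball_path_sym (ball_path_to1 yr)).
  by exists (size p), p.
move=> [p [pp py ap] <-] pL; exists (nth x (x :: p)), (size p); split=> //.
- by rewrite -py (last_nth x).
- by move=> i ip; apply: (allP ap); rewrite mem_nth //= ltnS.
by move=> i ip; have /(pathP x)/(_ i ip)/eqP := pp; rewrite /wdist => ->.
Qed.

End WordLength.

Section Height.
Variables (R : realType) (l : nat) (b : 'I_l -> R).
Implicit Types m : 'rV[int]_l.

Definition height m : R := \sum_i b i * (m 0 i)%:~R.

Lemma heightD m1 m2 : height (m1 + m2) = height m1 + height m2.
Proof.
by rewrite /height -big_split; apply: eq_bigr => i _; rewrite mxE rmorphD mulrDr.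
Qed.

Lemma height0 : height 0 = 0.
Proof. by rewrite /height big1 // => i _; rewrite mxE mulr0. Qed.

Lemma heightN m : height (- m) = - height m.
Proof. by apply/eqP; rewrite -addr_eq0 -heightD addNr height0. Qed.

Lemma height_delta i : height (delta_mx 0 i) = b i.
Proof.
rewrite /height (bigD1 i) //= big1 => [|j ji]; rewrite mxE ?eqxx ?(negPf ji) /=.
  by rewrite mulr1 addr0.
by rewrite mulr0.
Qed.

End Height.

Lemma heightZ (R : realType) (l : nat) (b : 'I_l -> R) (a : R) (m : 'rV[int]_l) :
  height (fun i => b i * a) m = height b m * a.
Proof. by rewrite /height mulr_suml; apply: eq_bigr => i _; rewrite mulrAC. Qed.

Lemma heightNb (R : realType) (l : nat) (b : 'I_l -> R) (m : 'rV[int]_l) :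
  height (fun i => - b i) m = - height b m.
Proof. by rewrite /height -sumrN; apply: eq_bigr => i _; rewrite mulNr. Qed.

Section Norm.
Variables (R : realType) (l : nat) (K : lmodType (laurent l)).
Implicit Types (m : 'rV[int]_l) (x y k : K).

Lemma scale_tmon m1 m2 k : tmon m1 *: (tmon m2 *: k) = tmon (m1 + m2) *: k.
Proof. by rewrite (scalerA (tmon m1) (tmon m2) k) -(tmonD m1 m2). Qed.

Lemma tmonK m : cancel ( *:%R (tmon m)) ( *:%R (tmon (- m)) : K -> K).
Proof. by move=> k; rewrite scale_tmon addNr tmon0 scale1r. Qed.

Lemma tmon_neq0 m k : k != 0 -> tmon m *: k != 0.
Proof. by apply: contraNneq => mk; rewrite -[k](tmonK m) mk scaler0. Qed.

(* Models exp (mu I), where t^m acts on I as a translation by e m / mu. *)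
Record twisted_norm (e : 'rV[int]_l -> R) (rho : K -> R) : Prop := TwistedNorm {
  tnorm0 : rho 0 = 0;
  tnorm_gt0 : forall x, x != 0 -> 0 < rho x;
  tnormN : forall x, rho (- x) = rho x;
  tnorm_sum : forall s : seq K, rho (\sum_(x <- s) x) <= 2 * \sum_(x <- s) rho x;
  tnorm_tmon : forall m x, rho (tmon m *: x) = expR (e m) * rho x }.

Lemma tnorm_ge0 e rho : twisted_norm e rho -> forall x, 0 <= rho x.
Proof.
move=> N x; have [->|x0] := eqVneq x 0; first by rewrite (tnorm0 N).
exact: ltW (tnorm_gt0 N x0).
Qed.

Section Valuation.
Variables (C : R) (b : 'I_l -> R) (I : K -> R).
Hypothesis It : forall k i, k != 0 -> I (tvar i *: k) = I k + b i.

Lemma valuation_tmon m k : k != 0 -> I (tmon m *: k) = I k + height b m.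
Proof.
pose P m := forall k, k != 0 -> I (tmon m *: k) = I k + height b m.
have P0 : P 0 by move=> k' _; rewrite tmon0 scale1r height0 addr0.
have PD m1 m2 : P m1 -> P m2 -> P (m1 + m2).
  move=> P1 P2 k' k0; rewrite -scale_tmon P1 ?tmon_neq0 // P2 // heightD.
  by rewrite addrAC addrA.
have PN m1 : P m1 -> P (- m1).
  move=> P1 k' k0; have := P1 _ (tmon_neq0 (- m1) k0).
  rewrite (scale_tmon m1 (- m1) k') (subrr m1) (tmon0 l) (scale1r k') heightN => ->.
  by rewrite addrK.
have Pn i n : P (delta_mx 0 i *+ n).
  elim: n => [|n IHn]; first by rewrite mulr0n.
  by rewrite mulrS; apply: PD IHn => k' k0; rewrite height_delta It.
suff: P m by apply.
rewrite [m]row_sum_delta; apply: (big_ind P) => // i _.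
rewrite -[m 0 i]intz scaler_int; case: (m 0 i) => n.
  exact: Pn.
by rewrite NegzE mulrNz; apply: PN; exact: Pn.
Qed.

Hypothesis IN : forall k, k != 0 -> I (- k) = I k.
Hypothesis ID : forall k1 k2, k1 != 0 -> k2 != 0 -> k1 + k2 != 0 ->
  I (k1 + k2) <= Num.max (I k1) (I k2) + C.

Lemma valuation_norm (mu : R) : 0 < mu -> mu * C <= ln 2 / 2 ->
  exists rho, twisted_norm (fun m => mu * height b m) rho.
Proof.
move=> mu0 muC; pose rho x := if x == 0 then 0 else expR (mu * I x).
have rho_gt0 x : x != 0 -> 0 < rho x.
  by rewrite /rho => /negPf ->; exact: expR_gt0.
have rho0 : rho 0 = 0 by rewrite /rho eqxx.
have rho_ge0 x : 0 <= rho x by rewrite /rho; case: ifP => // _; exact: expR_ge0.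
have ln2 : 0 < ln 2 :> R by rewrite ln_gt0 // ltr1n.
have lam1 : 1 <= expR (ln 2 / 2) :> R by rewrite -[leLHS]expR0 ler_expR divr_ge0 // ltW.
exists rho; split=> //.
- move=> x; rewrite /rho oppr_eq0; case: eqVneq => // x0; by rewrite IN.
- apply: (@quasinorm_sum_le _ _ _ (expR (ln 2 / 2))) => //.
    have -> : expR (ln 2 / 2) ^+ 2 = expR (ln 2) :> R by rewrite -expRM_natl; congr expR; lra.
    by rewrite lnK // posrE.
  move=> x y; have [->|x0] := eqVneq x 0.
    by rewrite add0r rho0 max_r // ler_peMl.
  have [->|y0] := eqVneq y 0; first by rewrite addr0 rho0 max_l // ler_peMl.
  have [->|xy0] := eqVneq (x + y) 0.
    by rewrite rho0 mulr_ge0 ?expR_ge0 // le_max rho_ge0.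
  rewrite /rho (negPf x0) (negPf y0) (negPf xy0).
  apply: (@le_trans _ _ (expR (ln 2 / 2) * expR (mu * Num.max (I x) (I y)))).
    rewrite -expRD ler_expR.
    have := ler_wpM2l (ltW mu0) (ID x0 y0 xy0); rewrite mulrDr; lra.
  rewrite ler_wpM2l ?expR_ge0 // le_max !ler_expR !ler_pM2l //.
  by case: (leP (I x) (I y)); rewrite lexx ?orbT.
move=> m x; rewrite /rho; have [->|x0] := eqVneq x 0.
  by rewrite scaler0 eqxx mulr0.
by rewrite (negPf (tmon_neq0 m x0)) valuation_tmon // mulrDr expRD mulrC.
Qed.

End Valuation.

Definition kappa (g : semidirect K) : K := tmon (- g.1) *: g.2.

Lemma kappa1 : kappa 1%g = 0.
Proof. by rewrite /kappa scaler0. Qed.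

Lemma kappaM (g u : semidirect K) :
  kappa (g * u)%g = kappa g + tmon (- g.1) *: kappa u.
Proof.
case: g u => [m1 k1] [m2 k2].
rewrite -[LHS]/(tmon (- (m1 + m2)) *: (tmon m2 *: k1 + k2)).
rewrite -[RHS]/(tmon (- m1) *: k1 + tmon (- m1) *: (tmon (- m2) *: k2)).
rewrite (scalerDr (tmon (- (m1 + m2))) (tmon m2 *: k1) k2).
rewrite (scale_tmon (- (m1 + m2)) m2 k1) (scale_tmon (- m1) (- m2) k2).
by rewrite (opprD m1 m2) (addrNK m2 (- m1)).
Qed.

End Norm.

Lemma ler_sum_mem (R : realFieldType) (T : eqType) (s : seq T) (F : T -> R) x :
  (forall y, 0 <= F y) -> x \in s -> F x <= \sum_(y <- s) F y.
Proof. by move=> F0 xs; rewrite (big_rem x) //= lerDl sumr_ge0. Qed.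

Lemma walk_crossing (R : realFieldType) (f : nat -> R) n :
  0 <= f 0%N -> f n <= 0 -> (forall i, (i < n)%N -> `|f i.+1 - f i| <= 1) ->
  exists2 j, (j <= n)%N & `|f j| <= 1.
Proof.
move=> f0; elim: n => [fn _|n IHn fn step].
  by exists 0%N => //; rewrite (le_anti (introT andP (conj fn f0))) normr0.
have [fn0|fn0] := leP (f n) 0.
  have [|j jn fj] := IHn fn0; first by move=> i /ltnW; exact: step.
  by exists j => //; exact: ltnW.
exists n => //; have := step n (leqnn _).
rewrite !ler_norml => /andP[? ?]; apply/andP; split; lra.
Qed.

Lemma expR_unbounded (R : realType) (mu X : R) : 0 < mu ->
  exists q : nat, forall n : nat, (q <= n)%N -> X < expR (mu * n%:R).
Proof.
move=> mu0; exists (Num.bound `|X / mu|) => n qn.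
have : X / mu < n%:R.
  rewrite (le_lt_trans (ler_norm _)) // (lt_le_trans (archi_boundP (normr_ge0 _))) //.
  by rewrite ler_nat.
rewrite ltr_pdivrMr // mulrC => lt1.
have := expR_ge1Dx (mu * n%:R); lra.
Qed.

Section Semidirect.
Variables (R : realType) (l : nat) (K : lmodType (laurent l)).
Variable S : {fset semidirect K}.
Hypothesis genS : generates S.
Implicit Types (g u z : semidirect K) (m : 'rV[int]_l) (k : K).

Lemma kappa_steps_bounded (rho : K -> R) : (forall x, 0 <= rho x) -> rho 0 = 0 ->
  exists2 A : R, 0 < A & forall g, (wlen S g <= 1)%N -> rho (kappa g) <= A.
Proof.
move=> rho_ge0 rho0; pose F g := rho (kappa g) + rho (kappa g^-1%g).
have F_ge0 g : 0 <= F g by rewrite addr_ge0.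
have leF (g : semidirect K) : g \in S -> F g <= 1 + \sum_(u <- S) F u.
  by move=> gS; rewrite ler_wpDl //; exact: ler_sum_mem.
exists (1 + \sum_(u <- S) F u) => [|g /(wlen_le1 genS)[->|/leF|/leF]].
- by rewrite ltr_wpDr // sumr_ge0.
- by rewrite kappa1 rho0 addr_ge0 // sumr_ge0.
- by apply: le_trans; rewrite lerDl.
- by apply: le_trans; rewrite /F invgK lerDr.
Qed.

Lemma norm_walk_le (e : 'rV[int]_l -> R) (rho : K -> R) (A : R) :
  twisted_norm e rho ->
  (forall g, (wlen S g <= 1)%N -> rho (kappa g) <= A) ->
  forall (P : nat -> semidirect K) n,
  (forall i, (i < n)%N -> (wlen S ((P i)^-1 * P i.+1)%g <= 1)%N) ->
  rho (kappa (P n) - kappa (P 0%N)) <= 2 * A * \sum_(i < n) expR (e (- (P i).1)).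
Proof.
move=> N Ale P n step.
rewrite -(telescope_sumr (fun i => kappa (P i)) (leq0n n)) big_mkord.
rewrite -(big_map (fun i : 'I_n => kappa (P i.+1) - kappa (P i)) xpredT id).
apply: le_trans (tnorm_sum N _) _; rewrite big_map -mulrA ler_pM2l // mulr_sumr.
apply: ler_sum => i _.
have -> : kappa (P i.+1) - kappa (P i) =
    tmon (- (P i).1) *: kappa ((P i)^-1 * P i.+1)%g.
  by rewrite -{1}[P i.+1](mulVKg (P i)) kappaM addrC addKr.
by rewrite (tnorm_tmon N) mulrC ler_wpM2r ?expR_ge0 // Ale // step.
Qed.

Variables (b : 'I_l -> R) (mu : R) (rho1 rho2 : K -> R).
Hypothesis mu_gt0 : 0 < mu.
Hypothesis norm1 : twisted_norm (fun m => mu * height b m) rho1.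
Hypothesis norm2 : twisted_norm (fun m => - (mu * height b m)) rho2.
Hypothesis height_step : forall g, (wlen S g <= 1)%N -> `|height b g.1| <= 1.

Lemma height_walk (P : nat -> semidirect K) n :
  (forall i, (i < n)%N -> (wlen S ((P i)^-1 * P i.+1)%g <= 1)%N) ->
  forall i, (i < n)%N -> `|height b (P i.+1).1 - height b (P i).1| <= 1.
Proof.
move=> step i /step /height_step.
by rewrite [((P i)^-1 * P i.+1)%g.1]/= heightD heightN addrC.
Qed.

Lemma norm_prod_le : exists2 c : R, 0 < c & forall z, `|height b z.1| <= 1 ->
  rho1 (kappa z) * rho2 (kappa z) <= c * expR (mu / 2 * ((wlen S z)%:R + 1)).
Proof.
have [A1 A1_gt0 leA1] := kappa_steps_bounded (tnorm_ge0 norm1) (tnorm0 norm1).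
have [A2 A2_gt0 leA2] := kappa_steps_bounded (tnorm_ge0 norm2) (tnorm0 norm2).
have [D D_gt0 leD] := walk_sum_prod_le mu_gt0.
exists (4 * A1 * A2 * D) => [|z hz]; first by rewrite !mulr_gt0.
have [P [P0 Pz step]] := walk_of_wlen genS z.
have le1 : rho1 (kappa z) <=
    2 * A1 * \sum_(i < wlen S z) expR (- (mu * height b (P i).1)).
  have := norm_walk_le norm1 leA1 step; rewrite P0 Pz kappa1 subr0.
  rewrite (eq_bigr (fun i : 'I_ _ => expR (- (mu * height b (P i).1)))) //.
  by move=> i _; rewrite heightN mulrN.
have le2 : rho2 (kappa z) <=
    2 * A2 * \sum_(i < wlen S z) expR (mu * height b (P i).1).
  have := norm_walk_le norm2 leA2 step; rewrite P0 Pz kappa1 subr0.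
  rewrite (eq_bigr (fun i : 'I_ _ => expR (mu * height b (P i).1))) //.
  by move=> i _; rewrite heightN mulrN opprK.
have := leD (fun i => height b (P i).1) _ (height_walk step).
rewrite P0 Pz => /(_ (height0 b) hz).
move: le1 le2 (tnorm_ge0 norm1 (kappa z)) (tnorm_ge0 norm2 (kappa z)).
set s1 := \sum_(i < _) _; set s2 := \sum_(i < _) _ => le1 le2 r1 r2 les.
apply: le_trans (ler_pM r1 r2 le1 le2) _.
rewrite [leLHS](_ : _ = 4 * A1 * A2 * (s2 * s1)); last by ring.
by rewrite -[leRHS]mulrA ler_wpM2l // !mulr_ge0 // ltW.
Qed.

Lemma far_norm_ge (e : 'rV[int]_l -> R) (rho : K -> R) k (d : K) (q : R) (L : nat) :
  twisted_norm e rho -> (forall m, e m <= mu * `|height b m|) -> k != 0 ->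
  exists N0 : nat, forall N, (N0 <= N)%N ->
    forall m, e m = mu * N%:R -> e (- m) <= 0 ->
    forall (P : nat -> semidirect K) j, (j <= L)%N ->
      (forall i, (i < j)%N -> (wlen S ((P i)^-1 * P i.+1)%g <= 1)%N) ->
      `|height b (P 0%N).1| <= q ->
      kappa (P 0%N) = tmon m *: k + tmon (- m) *: k + d ->
      expR (mu * N%:R) * rho k <= 4 * rho (kappa (P j)).
Proof.
move=> N e_le k_neq0; have rk := tnorm_gt0 N k_neq0.
have [A A_gt0 leA] := kappa_steps_bounded (tnorm_ge0 N) (tnorm0 N).
pose B := rho k + rho d + 2 * A * (L%:R * expR (mu * (q + L%:R))).
have [N0 ltN0] := expR_unbounded (4 * B / rho k) mu_gt0.
exists N0 => n /ltN0 lt_n m em emN P j jL step q_ge P0.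
have h_le i : (i <= j)%N -> `|height b (P i).1| <= q + i%:R.
  elim: i => [|i IHi] ij; first by rewrite addr0.
  rewrite -natr1 addrA -[height b (P i.+1).1](subrK (height b (P i).1)) addrC.
  by rewrite (le_trans (ler_normD _ _)) // lerD ?IHi ?(height_walk step) // ltnW.
have d_le : rho (kappa (P j) - kappa (P 0%N)) <=
    2 * A * (L%:R * expR (mu * (q + L%:R))).
  apply: le_trans (norm_walk_le N leA step) _.
  apply: ler_wpM2l; first by rewrite mulr_ge0 // ltW.
  apply: (@le_trans _ _ (\sum_(i < j) expR (mu * (q + L%:R)))).
    apply: ler_sum => i _; rewrite ler_expR (le_trans (e_le _)) // ler_pM2l //.
    rewrite heightN normrN (le_trans (h_le _ (ltnW (ltn_ord i)))) // lerD2l ler_nat.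
    by rewrite (leq_trans _ jL) // ltnW.
  by rewrite sumr_const card_ord -[leLHS]mulr_natl ler_wpM2r ?expR_ge0 // ler_nat.
have := tnorm_sum N [:: kappa (P j); - (tmon (- m) *: k); - d;
  - (kappa (P j) - kappa (P 0%N))].
rewrite !big_cons !big_nil !addr0 !(tnormN N) (tnorm_tmon N).
have -> : kappa (P j) + (- (tmon (- m) *: k) + (- d +
    - (kappa (P j) - kappa (P 0%N)))) = tmon m *: k.
  rewrite P0; move: (kappa (P j)) (tmon m *: k) (tmon (- m) *: k) => w u v.
  rewrite opprB [- d + _]addrC addrAC addrK [- v + _]addrC addrAC addrK.
  by rewrite addrCA subrr addr0.
rewrite (tnorm_tmon N) em.
have : expR (e (- m)) * rho k <= rho k.
  by apply: ler_piMl; [exact: ltW|rewrite -[leRHS]expR0 ler_expR].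
by move: lt_n; rewrite ltr_pdivrMr // /B; lra.
Qed.

Lemma kernel_conj (a : semidirect K) k :
  (a * ((0, k) : semidirect K) * a^-1)%g = (0, tmon (- a.1) *: k).
Proof.
case: a => [m u].
rewrite -[LHS]/(m + 0 - m, tmon (- m) *: (tmon 0 *: u + k) - tmon (- m) *: u).
rewrite -[RHS]/(0, tmon (- m) *: k); congr (_, _); first by rewrite addr0 subrr.
rewrite (tmon0 l) (scale1r u) (scalerDr (tmon (- m)) u k).
by rewrite addrAC (subrr (tmon (- m) *: u)) add0r.
Qed.

Lemma kernelM k1 k2 :
  (((0, k1) : semidirect K) * ((0, k2) : semidirect K))%g = (0, k1 + k2).
Proof.
rewrite -[LHS]/(0 + 0, tmon 0 *: k1 + k2) (tmon0 l) (scale1r k1); congr (_, _).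
by rewrite addr0.
Qed.

Lemma kappa_kernel k : kappa ((0, k) : semidirect K) = k.
Proof. by rewrite /kappa [(_, _).1]/= [(_, _).2]/= oppr0 (tmon0 l) scale1r. Qed.

Lemma heightX (s : semidirect K) n : height b (s ^+ n)%g.1 = height b s.1 * n%:R.
Proof.
elim: n => [|n IHn]; first by rewrite expg0 height0 mulr0.
by rewrite expgS -[(s * _)%g.1]/(s.1 + (s ^+ n)%g.1) heightD IHn -natr1; ring.
Qed.

End Semidirect.

Section Core.
Variables (R : realType) (l : nat) (K : lmodType (laurent l)).
Variable S : {fset semidirect K}.
Hypothesis genS : generates S.
Variables (b : 'I_l -> R) (mu : R) (rho1 rho2 : K -> R).
Hypothesis mu_gt0 : 0 < mu.
Hypothesis norm1 : twisted_norm (fun m => mu * height b m) rho1.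
Hypothesis norm2 : twisted_norm (fun m => - (mu * height b m)) rho2.
Hypothesis height_step : forall g, (wlen S g <= 1)%N -> `|height b g.1| <= 1.
Variables (s : semidirect K) (k : K).
Hypotheses (height_s : height b s.1 = 1) (wlen_s : (wlen S s <= 1)%N).
Hypothesis k_neq0 : k != 0.

Let kk : semidirect K := (0, k).
Let target (N : nat) : semidirect K :=
  (0, tmon (s ^+ N)%g.1 *: k + tmon (- (s ^+ N)%g.1) *: k).

Lemma targetE N : target N =
  ((s ^+ N)^-1 * kk * s ^+ N * (s ^+ N * kk * (s ^+ N)^-1))%g.
Proof.
rewrite kernel_conj -{2}[(s ^+ N)%g]invgK kernel_conj kernelM.
rewrite -[(s ^+ N)^-1%g.1]/(- (s ^+ N)%g.1).
by rewrite (opprK (s ^+ N)%g.1).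
Qed.

Lemma targetE' N : target N =
  (s ^+ N * kk * (s ^+ N)^-1 * ((s ^+ N)^-1 * kk * s ^+ N))%g.
Proof.
rewrite kernel_conj -{3}[(s ^+ N)%g]invgK kernel_conj kernelM.
rewrite -[(s ^+ N)^-1%g.1]/(- (s ^+ N)%g.1).
by rewrite (opprK (s ^+ N)%g.1) addrC.
Qed.

Lemma wlen_target_up N q : (q <= N)%N ->
  (wlen S (target N * s ^+ q)%g <= 4 * N - q + 2 * wlen S kk)%N.
Proof.
by move=> qN; rewrite targetE; exact: wlen_updown_le.
Qed.

Lemma wlen_target_down N q : (q <= N)%N ->
  (wlen S (target N * (s ^+ q)^-1)%g <= 4 * N - q + 2 * wlen S kk)%N.
Proof.
move=> qN; rewrite targetE'.
have := wlen_updown_le genS (g := s^-1%g) kk _ qN.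
by rewrite wlenV // !expVgn !invgK; apply.
Qed.

Lemma height_target N u : height b (target N * u)%g.1 = height b u.1.
Proof. by rewrite -[LHS]/(height b (0 + u.1)) heightD height0 add0r. Qed.

Lemma semidirect_not_almost_convex : ~ almost_convex S.
Proof.
have [c c_gt0 le_c] := norm_prod_le genS mu_gt0 norm1 norm2 height_step.
have r1 := tnorm_gt0 norm1 k_neq0; have r2 := tnorm_gt0 norm2 k_neq0.
pose ell := wlen S kk.
have mu2 : 0 < mu / 2 by rewrite divr_gt0.
have [q /(_ q (leqnn q)) q_large] := expR_unbounded
  (16 * c * expR (mu / 2 * (2 * ell%:R + 1)) / (rho1 k * rho2 k)) mu2.
rewrite ltr_pdivrMr ?mulr_gt0 // in q_large.
move=> /(_ (2 * q + 2)%N); apply; first by rewrite leq_addl.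
exists (fun N => target N * s ^+ q)%g, (fun N => target N * (s ^+ q)^-1)%g; split.
  move=> N; rewrite (leq_trans (wdist_mulV_le genS _ _)) //.
  by rewrite (leq_trans _ (leq_addr _ _)) // leq_mul2l wlenX_le1.
move=> L.
have [|N1 far1] := far_norm_ge genS mu_gt0 height_step (kappa (s ^+ q)%g) q%:R L norm1 _ k_neq0.
  by move=> m; rewrite ler_pM2l // ler_norm.
have [|N2 far2] := far_norm_ge genS mu_gt0 height_step (kappa (s ^+ q)%g) q%:R L norm2 _ k_neq0.
  by move=> m; rewrite -mulrN ler_pM2l // -normrN ler_norm.
exists (N1 + (N2 + q))%N => N N_ge; rewrite leqNgt; apply/negP.
have N1_le : (N1 <= N)%N := leq_trans (leq_addr _ _) N_ge.
have N2q_le : (N2 + q <= N)%N := leq_trans (leq_addl _ _) N_ge.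
have N2_le : (N2 <= N)%N := leq_trans (leq_addr _ _) N2q_le.
have qN : (q <= N)%N := leq_trans (leq_addl _ _) N2q_le.
set r := maxn _ _ => /(walk_of_ball_dist genS (leq_maxl _ _) (leq_maxr _ _)).
move=> [P [n [nL P0 Pn ball step]]].
have hq : height b (s ^+ q)%g.1 = q%:R by rewrite heightX height_s mul1r.
have hP0 : height b (P 0%N).1 = q%:R by rewrite P0 height_target hq.
have hPn : height b (P n).1 = - q%:R.
  by rewrite Pn height_target -[(s ^+ q)^-1%g.1]/(- (s ^+ q)%g.1) heightN hq.
have [||j jn hj] := @walk_crossing _ (fun i => height b (P i).1) n _ _
    (height_walk height_step step).
- by rewrite hP0.
- by rewrite hPn oppr_le0.
have wlen_j : (wlen S (P j) <= 4 * N - q + 2 * ell)%N.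
  by rewrite (leq_trans (ball j jn)) // geq_max wlen_target_up // wlen_target_down.
have [a [ha kP0]] : exists a, height b a = N%:R /\
    kappa (P 0%N) = tmon a *: k + tmon (- a) *: k + kappa (s ^+ q)%g.
  exists (s ^+ N)%g.1; split; first by rewrite heightX height_s mul1r.
  rewrite P0 kappaM kappa_kernel; congr (_ + _).
  rewrite -[(target N).1]/(0 : 'rV[int]_l) oppr0 (tmon0 l).
  exact: (scale1r (kappa (s ^+ q)%g)).
have kP0' : kappa (P 0%N) = tmon (- a) *: k + tmon (- - a) *: k + kappa (s ^+ q)%g.
  by rewrite (opprK a) (addrC (tmon (- a) *: k) (tmon a *: k)).
have stepj i : (i < j)%N -> (wlen S ((P i)^-1 * P i.+1)%g <= 1)%N.
  by move=> ij; apply: step; exact: leq_trans jn.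
have jL : (j <= L)%N := leq_trans jn (ltnW nL).
have hP0q : `|height b (P 0%N).1| <= q%:R by rewrite hP0 ger0_norm.
have N_ge0 : 0 <= mu * N%:R by rewrite mulr_ge0 // ltW.
have hNa : mu * height b (- a) = - (mu * N%:R) by rewrite heightN ha mulrN.
have ge1 : expR (mu * N%:R) * rho1 k <= 4 * rho1 (kappa (P j)).
  have ea : mu * height b a = mu * N%:R by rewrite ha.
  have ea' : mu * height b (- a) <= 0 by rewrite hNa oppr_le0.
  exact: (far1 N N1_le a ea ea' P j jL stepj hP0q kP0).
have ge2 : expR (mu * N%:R) * rho2 k <= 4 * rho2 (kappa (P j)).
  have ea : - (mu * height b (- a)) = mu * N%:R by rewrite hNa opprK.
  have ea' : - (mu * height b (- - a)) <= 0 by rewrite (opprK a) ha oppr_le0.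
  exact: (far2 N N2_le (- a) ea ea' P j jL stepj hP0q kP0').
have := le_c _ hj; apply/negP; rewrite -ltNge.
have wlen_jR : (wlen S (P j))%:R <= 4 * N%:R - q%:R + 2 * ell%:R :> R.
  have q4N : (q <= 4 * N)%N by rewrite (leq_trans qN) // leq_pmull.
  by rewrite -!natrM -(natrB _ q4N) -natrD ler_nat.
apply: (@le_lt_trans _ _ (c * expR (mu / 2 * (4 * N%:R - q%:R + 2 * ell%:R + 1)))).
  by rewrite ler_pM2l // ler_expR ler_pM2l // lerD2r.
have E_gt0 : 0 < expR (mu * N%:R) :> R by exact: expR_gt0.
have e1_ge0 : 0 <= expR (mu * N%:R) * rho1 k by rewrite mulr_ge0 // ltW.
have e2_ge0 : 0 <= expR (mu * N%:R) * rho2 k by rewrite mulr_ge0 // ltW.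
rewrite -(@ltr_pM2l _ 16) //.
rewrite [ltRHS](_ : _ = 4 * rho1 (kappa (P j)) * (4 * rho2 (kappa (P j)))); last by ring.
apply: lt_le_trans (ler_pM e1_ge0 e2_ge0 ge1 ge2).
have -> : mu / 2 * (4 * N%:R - q%:R + 2 * ell%:R + 1) =
  mu * N%:R + mu * N%:R + mu / 2 * (2 * ell%:R + 1) - mu / 2 * q%:R :> R by lra.
rewrite !expRD expRN !mulrA ltr_pdivrMr ?expR_gt0 //.
set E := expR (mu * N%:R) in E_gt0 *; set Q := expR (mu / 2 * q%:R) in q_large *.
rewrite [ltLHS](_ : _ = E * E * (16 * c * expR (mu / 2 * (2 * ell%:R + 1)))); last by ring.
rewrite [ltRHS](_ : _ = E * E * (Q * (rho1 k * rho2 k))); last by ring.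
by rewrite ltr_pM2l // mulr_gt0.
Qed.

End Core.

Lemma seq_argmax (R : realDomainType) (T : eqType) (f : T -> R) (s : seq T) x0 :
  x0 \in s -> exists2 x, x \in s & forall y, y \in s -> f y <= f x.
Proof.
elim: s x0 => // a [|a' s] IHs x0 _.
  by exists a; rewrite ?inE // => y; rewrite inE => /eqP ->.
have [x xs maxx] := IHs a' (mem_head _ _).
have [le_ax|lt_xa] := leP (f a) (f x).
  exists x => [|y]; first by rewrite inE xs orbT.
  by rewrite in_cons => /predU1P[->|/maxx].
exists a => [|y]; first exact: mem_head.
by rewrite in_cons => /predU1P[->|/maxx/le_trans->] //; exact: ltW.
Qed.

Lemma steepest_generator (R : realType) (l : nat) (K : lmodType (laurent l))
    (b : 'I_l -> R) (S : {fset semidirect K}) :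
  (exists i, b i != 0) -> generates S ->
  exists s : semidirect K, [/\ 0 < height b s.1, (wlen S s <= 1)%N &
    forall g, (wlen S g <= 1)%N -> `|height b g.1| <= height b s.1].
Proof.
move=> [i bi] genS.
have heightV (g : semidirect K) : height b g^-1%g.1 = - height b g.1.
  by rewrite -heightN.
have [s0 s0S hs0] : exists2 s0, s0 \in S & height b s0.1 != 0.
  have [w [wS wi]] := genS ((delta_mx 0 i, 0) : semidirect K).
  apply: contrapT => all0.
  have h0 g : g \in S -> height b g.1 = 0.
    by move=> gS; apply: contrapT => hg; apply: all0; exists g => //; apply/eqP.
  suff : height b ((\big[*%g/1%g]_(s <- w) s)%g : semidirect K).1 = 0.
    by rewrite wi height_delta => bi0; rewrite bi0 eqxx in bi.
  elim: w wS {wi} => [_|a w IHw /=]; first by rewrite big_nil height0.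
  move=> /andP[aS /IHw IH]; rewrite big_cons.
  rewrite -[(a * _)%g.1]/(a.1 + (\big[*%g/1%g]_(s <- w) s)%g.1) heightD IH addr0.
  by case/orP: aS => /h0 //; rewrite heightV => /eqP; rewrite oppr_eq0 => /eqP.
have [s sS maxs] := seq_argmax (fun g : semidirect K => `|height b g.1|) s0S.
have s_gt0 : 0 < `|height b s.1|.
  by apply: lt_le_trans (maxs _ s0S); rewrite normr_gt0.
have le_s g : (wlen S g <= 1)%N -> `|height b g.1| <= `|height b s.1|.
  move=> /(wlen_le1 genS)[->|/maxs //|/maxs]; first by rewrite height0 normr0.
  by rewrite heightV normrN.
have [s_ge0|s_lt0] := leP 0 (height b s.1).
  rewrite (ger0_norm s_ge0) in s_gt0 le_s.
  by exists s; split=> //; exact: wlen_mem_le1.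
exists s^-1%g; rewrite heightV -(ltr0_norm s_lt0) wlenV //.
by split=> //; exact: wlen_mem_le1.
Qed.

Theorem theorem4 (R : realType) (l : nat) (K : lmodType (laurent l))
    (C : R) (b : 'I_l -> R) (I1 I2 : K -> R) (S : {fset semidirect K}) :
  pair_of_valuations C b I1 I2 ->
  (exists k : K, k != 0) ->
  (exists i : 'I_l, b i != 0) ->
  generates S ->
  ~ almost_convex S.
Proof.
move=> [I1t I2t IN ID] [k k_neq0] b_neq0 genS.
have [s [M_gt0 wlen_s maxs]] := steepest_generator b_neq0 genS.
set M := height b s.1 in M_gt0 maxs.
pose C' := Num.max C 1.
have C'_gt0 : 0 < C' by rewrite lt_max ltr01 orbT.
have ln2 : 0 < ln 2 :> R by rewrite ln_gt0 // ltr1n.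
pose eps := ln 2 / 2 / C'.
have eps_gt0 : 0 < eps by rewrite !divr_gt0.
have epsC : eps * C <= ln 2 / 2.
  by rewrite /eps -mulrA ler_piMr ?divr_ge0 ?(ltW ln2) // mulrC ler_pdivrMr // mul1r le_max lexx.
have mu_gt0 : 0 < eps * M by rewrite mulr_gt0.
have heightM m : eps * M * height (fun i => b i * M^-1) m = eps * height b m.
  by rewrite heightZ; field; rewrite gt_eqF.
have [rho1 n1] := valuation_norm I1t (fun k k0 => (IN k k0).1)
  (fun k1 k2 h1 h2 h12 => (ID k1 k2 h1 h2 h12).1) eps_gt0 epsC.
have [rho2 n2] := @valuation_norm R l K C (fun i => - b i) I2 I2t (fun k k0 => (IN k k0).2)
  (fun k1 k2 h1 h2 h12 => (ID k1 k2 h1 h2 h12).2) eps eps_gt0 epsC.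
have norm1 : twisted_norm (fun m => eps * M * height (fun i => b i * M^-1) m) rho1.
  by rewrite (funext heightM).
have norm2 : twisted_norm (fun m => - (eps * M * height (fun i => b i * M^-1) m)) rho2.
  case: n2 => a1 a2 a3 a4 a5; split=> // m x.
  by rewrite a5 heightM heightNb mulrN.
apply: (semidirect_not_almost_convex genS mu_gt0 norm1 norm2 _ _ wlen_s k_neq0).
  by move=> g /maxs; rewrite heightZ normrM normfV (gtr0_norm M_gt0) ler_pdivrMr // mul1r.
by rewrite heightZ divff // gt_eqF.
Qed.
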